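(* Let $q$ be a prime power, let $b(T)\in\mathbb F_q[T]$ have degree $m\ge 1$, let $\ell\ge1$, and let $\langle \mathrm{Trun}^L_{q,b}\rangle_{b^\ell}:=\frac{1}{q^{m\ell}}\sum_{f\in\mathbb F_q[T],\ \deg f<m\ell}\mathrm{Trun}^L_{q,b}(f)$. Then \[\langle \mathrm{Trun}^L_{q,b}\rangle_{b^\ell} = \sum_{\substack{1 \le h < m \ell \\ h \equiv -1 \pmod m}} \frac 1h + O\left(\frac{\log \ell}{mq} + \frac 1q \right) \text{ as } q \to \infty,\] \[\langle \mathrm{Trun}^L_{q,b}\rangle_{b^\ell} = \frac 1m \sum_{h=1}^\ell \frac 1h + \frac{q}{(q-1)m^2} \sum_{h=1}^\ell \frac 1{h^2} + O\left(\frac 1{m^3} + \frac{q \log^2(m\ell)}{q^{m/2}}\right) \text{ as } m \to \infty,\] and \[\langle \mathrm{Trun}^L_{q,b}\rangle_{b^\ell} = \frac{1}m \left(1-\frac{1}{q^m}\right)\log \ell + O\left(\frac 1m + \frac 1q \right) \text{ as } \ell \to \infty.\]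
   Context: For $f\in\mathbb F_q[T]$, $\mathrm{Trun}^L_{q,b}(f)$ is the number of irreducible (not necessarily monic) polynomials $g\in\mathbb F_q[T]$ with $\deg g\le \deg f$ and $g\equiv f \pmod{b^{\lfloor \deg(g)/m\rfloor+1}}$; equivalently, writing $f=\sum_j a_j(T)b(T)^j$ with $\deg a_j<m$, these $g$ are the irreducible polynomials among the truncations $\sum_{j=0}^i a_j b^j$ with $a_i\ne0$. Implied constants in error terms are independent of $q$, $m$, $\ell$ (and $b$). *)

(* Defs.v *)
From HB Require Import structures.
From mathcomp Require Import all_boot all_order all_algebra.
From mathcomp Require Import all_classical all_reals all_analysis.

Set Implicit Arguments.
Unset Strict Implicit.
Unset Printing Implicit Defensive.
Import Order.TTheory GRing.Theory Num.Theory.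
Local Open Scope ring_scope.

(* {poly_n F} is the finite type of polynomials p with size p <= n, that is
   deg p < n.  Hence g : {poly_(size f) F} encodes deg g <= deg f (no nonzero g
   when f = 0), and the degree of a nonzero g is (size g).-1. *)
Definition truncL (F : finFieldType) (b f : {poly F}) : nat :=
  #|[set g : {poly_(size f) F} |
      `[< irreducible_poly g >] &&
      (b ^+ ((size g).-1 %/ (size b).-1).+1 %| (g : {poly F}) - f)]|.

Definition mean_truncL (R : realType) (F : finFieldType) (b : {poly F})
    (l : nat) : R :=
  (#|F|%:R ^+ ((size b).-1 * l))^-1 *
  \sum_(f : {poly_((size b).-1 * l) F}) (truncL b f)%:R.

(* Main.v *)
(** An irreducible [g] of degree [h] is a truncation of exactly [q^(m l - m k)]
    polynomials [f] of degree [< m l], where [k = h / m + 1].  Writing [pi] for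
    the number of monic irreducibles, the mean is therefore the sum over
    [1 <= k <= l] and [1 <= r <= m] of [(q - 1) pi(m k - r) / q^(m k)].

    Since ['X^(q^n) - 'X] is squarefree and its monic irreducible factors are
    those of degree dividing [n], [pi(h) = q^h / h - e] with
    [0 <= e <= 2 q^(h/2) / h] and [e = 0] for [h = 1].  Replacing [pi(h)] by
    [q^h / h] costs at most [O(1/q)], and also at most [O(q^((1-m)/2))].

    The remaining sum has terms [w_r / (m k - r)] with the weights
    [w_r = (q - 1) / q^r], whose moments are bounded uniformly in [q]; keeping
    only [r = 1], or expanding [1 / (m k - r)] to second or to first order in
    [r / (m k)], gives the three estimates. *)

Require Import Defs.
From HB Require Import structures.
From mathcomp Require Import all_boot all_order all_algebra all_field.
From mathcomp Require Import all_classical all_reals all_analysis.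
From mathcomp Require Import zify ring lra.
Set Implicit Arguments.
Unset Strict Implicit.
Unset Printing Implicit Defensive.
Import Order.TTheory GRing.Theory Num.Theory.
Local Open Scope ring_scope.

(** * Counting irreducible polynomials *)

Section Irreducibles.
Variable F : finFieldType.
Implicit Types (g h p u : {poly F}) (d n : nat).
Local Notation q := #|F|.

Lemma pnat_pchar_poly n : [pchar {poly F}].-nat (q ^ n)%N.
Proof.
have [p p_pr pF] := finPcharP F.
rewrite (card_pprimeChar pF) pnatX pnatX pnatE //.
by rewrite (_ : p \in [pchar {poly F}]) // pchar_poly.
Qed.

(** The [q^n]-th power map is additive in positive characteristic and fixes the coefficients, so it
    only moves the variable. *)
Lemma expr_card_comp h n : h ^+ (q ^ n) = h \Po 'X^(q ^ n).
Proof.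
have xq (x : F) : x ^+ (q ^ n) = x.
  by elim: n => [|n IHn]; rewrite ?expr1 // expnSr exprM IHn expf_card.
elim/poly_ind: h => [|h c IHh].
  by rewrite comp_poly0 expr0n expn_eq0 eqn0Ngt (ltnW (finNzRing_gt1 F)).
by rewrite (exprDn_pchar _ _ (pnat_pchar_poly n)) exprMn IHh comp_polyD
  comp_polyM comp_polyX comp_polyC -polyC_exp xq.
Qed.

Lemma in_qpoly_eq0 g u : monic_irreducible_poly g ->
  (in_qpoly g u == 0) = (g %| u).
Proof.
move=> gI; rewrite -val_eqE /= -Pdiv.IdomainMonic.modpE ?monic_mk_monic //.
by rewrite mk_monicE.
Qed.

(** The residue field of [g] has [q^deg g] elements, so the class of ['X] is fixed by that power. *)
Lemma irreducible_dvd_genpoly g : monic_irreducible_poly g ->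
  g %| 'X^(q ^ (size g).-1) - 'X.
Proof.
move=> gI; rewrite -(in_qpoly_eq0 _ gI) rmorphB rmorphXn subr_eq0 /=.
rewrite -(card_qfpoly gI); apply/eqP.
exact: (expf_card (in_qpoly g 'X : {poly %/ g with gI})).
Qed.

Lemma size_genpoly N : (1 < N)%N -> size ('X^N - 'X : {poly F}) = N.+1.
Proof.
by move=> N1; rewrite size_polyDl size_polyXn // size_polyN size_polyX.
Qed.

(** With [d = deg g], all [q^d] elements of the residue field are fixed by the powers [q^n] and
    [q^d], hence by [q^(n %% d)]. A nonzero remainder would give ['X^(q^(n %% d)) - 'X] more roots
    than its degree. *)
Lemma degree_dvd g n : monic_irreducible_poly g -> g %| 'X^(q ^ n) - 'X ->
  ((size g).-1 %| n)%N.
Proof.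
move=> gI gn; pose K : finFieldType := {poly %/ g with gI}.
set d := (size g).-1.
have cK : #|K| = (q ^ d)%N := card_qfpoly gI.
have d_gt0 : (0 < d)%N by have [[+ _] _] := gI; rewrite /d; case: size => [|[]].
(* Every class is a polynomial in the class of ['X], and the latter is fixed by hypothesis. *)
have yn (y : K) : y ^+ (q ^ n) = y.
  have yE : y = in_qpoly g (val y) :> {poly %/ g}.
    by apply/val_inj; rewrite [RHS]in_qpoly_small // size_mk_monic.
  have gX : in_qpoly g 'X^(q ^ n) = in_qpoly g 'X.
    by apply/eqP; rewrite -subr_eq0 -rmorphB in_qpoly_eq0.
  have : in_qpoly g (val y) ^+ (q ^ n) = in_qpoly g (val y).
    rewrite -rmorphXn /= expr_card_comp in_qpoly_comp_horner gX.
    by rewrite -in_qpoly_comp_horner comp_polyXr.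
  by rewrite -yE.
have yd (y : K) k : y ^+ (q ^ (k * d)) = y.
  elim: k => [|k IHk]; first by rewrite expr1.
  by rewrite mulSnr expnD exprM IHk -cK expf_card.
have yr (y : K) : y ^+ (q ^ (n %% d)) = y.
  by rewrite -{2}(yn y) {2}(divn_eq n d) expnD exprM yd.
rewrite /dvdn; apply: contraTT (ltn_pmod n d_gt0); rewrite -lt0n -leqNgt => r_gt0.
have qr1 : (1 < q ^ (n %% d))%N.
  by rewrite -(exp1n (n %% d)) ltn_exp2r // finNzRing_gt1.
have sP : size ('X^(q ^ (n %% d)) - 'X : {poly K}) = (q ^ (n %% d)).+1.
  by rewrite size_polyDl size_polyXn // size_polyN size_polyX.
have : (size (enum K) < (q ^ (n %% d)).+1)%N.
  rewrite -sP; apply: max_poly_roots; rewrite ?enum_uniq //.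
    by rewrite -size_poly_eq0 sP.
  by apply/allP => y _; rewrite rootE !hornerE yr subrr.
by rewrite -cardE cK ltnS leq_exp2l ?finNzRing_gt1.
Qed.

Definition monic_irr d : seq {poly F} :=
  [seq polyn f | f : {poly_d.+1 F} <- enum {poly_d.+1 F} &
    [&& `[< irreducible_poly f >], polyn f \is monic & size f == d.+1]].

Lemma monic_irrP d p :
  reflect (monic_irreducible_poly p * (size p = d.+1)) (p \in monic_irr d).
Proof.
apply: (iffP mapP) => [[p' + ->]|[[pI pM] sp]].
  by rewrite mem_filter => /andP[/and3P[/asboolP ? ? /eqP ?] _].
have spl : p \is a poly_of_size d.+1 by rewrite qualifE /= sp.
exists (NPoly spl) => //; rewrite mem_filter mem_enum andbT /= pM sp eqxx !andbT.
exact/asboolP.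
Qed.

Lemma uniq_monic_irr d : uniq (monic_irr d).
Proof. by rewrite map_inj_uniq => [|x y /val_inj] //; exact/filter_uniq/enum_uniq. Qed.

Lemma coprime_monic_irr g h : monic_irreducible_poly g ->
  monic_irreducible_poly h -> g != h -> coprimep g h.
Proof.
move=> [gI gM] [hI hM]; rewrite (irreducible_poly_coprime h gI); apply: contra.
move=> gh; have [h1 hd] := hI; have [g1 _] := gI.
have : g %= h by apply: hd => //; case: size g1 => [|[]].
by rewrite eqp_monic.
Qed.

(** Distinct monic irreducibles are coprime, so their divisibilities combine by Gauss's lemma. *)
Lemma prod_monic_irr_dvd (s : seq {poly F}) u : uniq s ->
  {in s, forall g, monic_irreducible_poly g * (g %| u)} ->
  \prod_(g <- s) g %| u.
Proof.
move=> + sP; elim: s sP => [|g s IHs] sP /=; first by rewrite big_nil dvd1p.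
move=> /andP[gs us]; rewrite big_cons.
have [gI gu] := sP g (mem_head _ _).
have sP' h : h \in s -> monic_irreducible_poly h * (h %| u).
  by move=> hs; apply: sP; rewrite in_cons hs orbT.
rewrite Gauss_dvdp ?gu ?IHs //.
rewrite big_seq; apply: (big_ind (fun v => coprimep g v)) => [|v w gv gw|h hs].
- exact: coprimep1.
- by rewrite coprimepMr gv.
- by apply: coprime_monic_irr (sP' _ hs).1 _ => //; apply: contraNneq gs => ->.
Qed.

Lemma monic_irr_factor p : (1 < size p)%N ->
  exists2 g, monic_irreducible_poly g & g %| p.
Proof.
have [n] := ubnP (size p); elim: n => // n IHn in p * => sp p1.
have p0 : p != 0 by rewrite -size_poly_gt0 ltnW.
have lp0 : lead_coef p != 0 by rewrite lead_coef_eq0.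
have [pI|pNI] := pselect (irreducible_poly p).
  exists ((lead_coef p)^-1 *: p); last by rewrite dvdpZl ?invr_eq0.
  split; last by rewrite monicE lead_coefZ mulVf.
  split=> [|u u1]; first by rewrite size_scale ?invr_eq0.
  rewrite dvdpZr ?invr_eq0 // => /(pI.2 _ u1) up.
  by rewrite (eqp_trans up) // eqp_sym eqp_scale // invr_eq0.
have [u [u1 up uNp]] : exists u, [/\ size u != 1, u %| p & ~~ (u %= p)].
  apply: contrapT => H; apply: pNI; split => // u u1 up.
  by apply: contrapT => /negP uNp; apply: H; exists u.
have u0 : u != 0 by apply: contraTneq up => ->; rewrite dvd0p.
have u_lt : (size u < size p)%N.
  by rewrite ltn_neqAle dvdp_leq // andbT dvdp_size_eqp.
have [||g gI gu] := IHn u; first exact: leq_trans u_lt _.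
  by rewrite ltn_neqAle eq_sym u1 size_poly_gt0.
by exists g => //; exact: dvdp_trans gu up.
Qed.

(** Induction on the size: when a monic irreducible factor [g] is split off, separability makes it
    coprime to the cofactor, so the two divisibilities multiply. *)
Lemma separable_dvd p u : separable_poly p ->
  (forall g, monic_irreducible_poly g -> g %| p -> g %| u) -> p %| u.
Proof.
have [n] := ubnP (size p); elim: n => // n IHn in p * => sp sepp H.
have p0 := separable_poly_neq0 sepp.
have [p1|p1] := leqP (size p) 1.
  have /eqp_dvdl -> : p %= 1 by rewrite -size_poly_eq1 eqn_leq p1 size_poly_gt0.
  exact: dvd1p.
have [g gI gp] := monic_irr_factor p1.
move: (gp) sepp H sp p0; rewrite dvdp_eq mulrC => /eqP ->; set v : {poly F} := p %/ g.
rewrite separable_mul mulf_eq0 negb_or => /and3P[_ sepv gv] H sp /andP[g0 v0].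
rewrite Gauss_dvdp // H ?dvdp_mulr //=; apply: IHn => //; last first.
  by move=> h hI hv; apply: H => //; rewrite dvdp_mull.
move: sp; rewrite size_mul //; have [[+ _] _] := gI.
by have := size_poly_gt0 v; rewrite v0; move: (size g) (size v) => a c; lia.
Qed.

(** The derivative is [-1], because [q^n] vanishes in [F]. *)
Lemma separable_genpoly n : (0 < n)%N -> separable_poly ('X^(q ^ n) - 'X : {poly F}).
Proof.
move=> n0; rewrite unlock derivB derivXn derivX.
have -> : 'X^((q ^ n).-1) *+ (q ^ n) = 0 :> {poly F}.
  rewrite -mulr_natr -polyC_natr; have [p p_pr pF] := finPcharP F.
  suff -> : (q ^ n)%:R = 0 :> F by rewrite mulr0.
  apply/eqP; rewrite -(dvdn_pcharf pF) dvdn_exp //.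
  have := finNzRing_gt1 F; rewrite [X in (_ < X)%N](card_pprimeChar pF).
  rewrite [X in (_ %| X)%N](card_pprimeChar pF).
  by case: (logn _ _) => [|e _] //; rewrite expnS dvdn_mulr.
by rewrite sub0r -[- 1]scaleN1r coprimepZr ?coprimep1 // oppr_eq0 oner_eq0.
Qed.

Lemma size_prod_monic_irr (s : seq {poly F}) :
  {in s, forall g, monic_irreducible_poly g} ->
  (size (\prod_(g <- s) g)).-1 = (\sum_(g <- s) (size g).-1)%N.
Proof.
elim: s => [|g s IHs] sP; first by rewrite !big_nil size_poly1.
have sP' : {in s, forall g, monic_irreducible_poly g}.
  by move=> h hs; apply: sP; rewrite in_cons hs orbT.
have gM : g \is monic by have [_] := sP g (mem_head _ _).
have pM : \prod_(h <- s) h \is monic.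
  by rewrite big_seq; apply: monic_prod => h /sP'[].
rewrite !big_cons -(IHs sP') size_monicM // ?monic_neq0 //.
have := size_poly_gt0 g; have := size_poly_gt0 (\prod_(h <- s) h).
rewrite !monic_neq0 //; lia.
Qed.

Lemma sum_size_monic_irr d :
  (\sum_(g <- monic_irr d) (size g).-1 = d * size (monic_irr d))%N.
Proof.
rewrite big_seq (eq_bigr (fun=> d)) => [|g /monic_irrP[_ ->]] //.
by rewrite -big_seq big_const_seq count_predT iter_addn_0.
Qed.

(** The product of the monic irreducibles of degree [d] divides ['X^(q^d) - 'X]; compare degrees. *)
Lemma monic_irr_upper d : (0 < d)%N -> (d * size (monic_irr d) <= q ^ d)%N.
Proof.
move=> d0; have q1 : (1 < q ^ d)%N by rewrite -(exp1n d) ltn_exp2r // finNzRing_gt1.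
have : \prod_(g <- monic_irr d) g %| 'X^(q ^ d) - 'X.
  apply: prod_monic_irr_dvd (uniq_monic_irr d) _ => g /monic_irrP[gI sg].
  by split=> //; have := irreducible_dvd_genpoly gI; rewrite sg.
move=> /dvdp_leq; rewrite -size_poly_eq0 size_genpoly // => /(_ isT) Hs.
rewrite -sum_size_monic_irr -size_prod_monic_irr; first by move: Hs; case: (size _).
by move=> g /monic_irrP[].
Qed.

(** Conversely, the separable polynomial ['X^(q^n) - 'X] divides the product of all monic
    irreducibles whose degree divides [n]. *)
Lemma monic_irr_lower_div n : (0 < n)%N ->
  (q ^ n <= \sum_(d <- divisors n) d * size (monic_irr d))%N.
Proof.
move=> n0; have q1 : (1 < q ^ n)%N by rewrite -(exp1n n) ltn_exp2r // finNzRing_gt1.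
pose s := flatten [seq monic_irr d | d <- divisors n].
have sI : {in s, forall g, monic_irreducible_poly g}.
  by move=> g /flatten_mapP[d _ /monic_irrP[]].
have : 'X^(q ^ n) - 'X %| \prod_(g <- s) g.
  apply: separable_dvd => [|g gI gn]; first exact: separable_genpoly.
  have gs : g \in s.
    apply/flatten_mapP; exists (size g).-1; first by rewrite -dvdn_divisors // degree_dvd.
    by apply/monic_irrP; split=> //; have [[]] := gI; case: size.
  by rewrite (big_rem _ gs) dvdp_mulr.
move=> /dvdp_leq; rewrite size_genpoly // monic_neq0; last first.
  by rewrite big_seq; apply: monic_prod => g /sI[].
move=> /(_ isT) Hs; have sE := size_prod_monic_irr sI.
have <- : (\sum_(g <- s) (size g).-1 = \sum_(d <- divisors n) d * size (monic_irr d))%N.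
  by rewrite big_flatten big_map; apply: eq_bigr => d _; rewrite sum_size_monic_irr.
by rewrite -sE; move: Hs; case: (size _).
Qed.

Lemma sum_expn_le x n : (1 < x)%N -> (\sum_(1 <= d < n.+1) x ^ d <= 2 * x ^ n)%N.
Proof.
move=> x1; elim: n => [|n IHn]; first by rewrite big_geq.
by rewrite big_nat_recr //= expnS; nia.
Qed.

(** Proper divisors of [n] are at most [n / 2], so by [monic_irr_upper] they contribute at most a
    geometric sum. The factor [1 < n] records that [1] has no proper divisor. *)
Lemma monic_irr_lower n : (0 < n)%N ->
  (q ^ n <= n * size (monic_irr n) + (1 < n) * (2 * q ^ (n %/ 2)))%N.
Proof.
move=> n0; apply: (leq_trans (monic_irr_lower_div n0)).
rewrite (bigD1_seq n) ?divisors_id ?divisors_uniq //= leq_add2l.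
have -> : (\sum_(d <- divisors n | d != n) d * size (monic_irr d) =
  \sum_(d <- [seq d <- divisors n | d != n]) d * size (monic_irr d))%N.
  by rewrite big_filter.
have [n1|n1] := leqP n 1.
  by rewrite big_filter (_ : n = 1%N) ?big_cons ?big_nil //; lia.
rewrite mul1n; apply: leq_trans (sum_expn_le _ (finNzRing_gt1 F)).
have sub : {subset [seq d <- divisors n | d != n] <= index_iota 1 (n %/ 2).+1}.
  move=> d; rewrite mem_filter mem_index_iota -dvdn_divisors // => /andP[dn].
  move=> /dvdnP[k nE]; rewrite nE in n0 n1 dn *.
  case: k nE n0 n1 dn => [|[|k]] nE n0 n1 dn; nia.
rewrite big_seq_cond.
apply: (@leq_trans (\sum_(d <- [seq d <- divisors n | d != n]) q ^ d)%N).
  rewrite [leqRHS]big_seq_cond; apply: leq_sum => d; rewrite andbT => /sub.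
  by rewrite mem_index_iota => /andP[d0 _]; exact: monic_irr_upper.
apply: uniq_sub_le_big; rewrite ?filter_uniq ?divisors_uniq ?iota_uniq //.
by move=> x y; exact: leq_addr.
Qed.
End Irreducibles.

(** * Elementary sums *)

Section ElementarySums.
Variable R : realType.
Implicit Types (t x : R) (k l m n r N : nat).

(** Each block of [m] consecutive degrees is read downwards, so that [r.+1] is the distance to the
    next multiple of [m]. *)
Lemma sum_blocks (G : nat -> R) m l :
  \sum_(h < m * l) G h = \sum_(k < l) \sum_(r < m) G (m * k.+1 - r.+1)%N.
Proof.
elim: l => [|l IHl]; first by rewrite muln0 !big_ord0.
rewrite big_ord_recr /= -IHl mulnSr big_split_ord /=; congr (_ + _).
rewrite (reindex_inj rev_ord_inj) /=; apply: eq_bigr => r _.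
by rewrite addnBA ?ltn_ord.
Qed.

(** Used for powers of [1 / sqrt q], which is at most [3 / 4]; the constant is
    [4 = 1 / (1 - 3 / 4)]. *)
Lemma geometric_sum_le t n : 0 <= t <= 3 / 4 -> \sum_(i < n) t ^+ i.+1 <= 4 * t.
Proof.
(* The extra factor [1 - t^n] makes the induction close: its step reduces to [1 <= 4 * (1 - t)]. *)
move=> /andP[t0 t1]; suff : \sum_(i < n) t ^+ i.+1 <= 4 * t * (1 - t ^+ n).
  by have := exprn_ge0 n t0; nra.
elim: n => [|n IHn]; first by rewrite big_ord0 expr0; lra.
rewrite big_ord_recr /= exprS; have a0 := exprn_ge0 n t0.
have t2 : 0 <= 3 / 4 - t by rewrite subr_ge0.
have := mulr_ge0 (mulr_ge0 t0 a0) t2.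
by move: (t ^+ n) IHn => a; lra.
Qed.

Lemma geometric_tail_le t N : 0 <= t <= 3 / 4 ->
  \sum_(h < N) (1 < h)%N%:R * t ^+ h <= 4 * t ^+ 2.
Proof.
move=> tP; have /andP[t0 _] := tP.
(* Two more terms are added so that the vanishing terms [h = 0] and [h = 1] can be peeled off for
   every [N]. *)
apply: (@le_trans _ _ (\sum_(h < N.+2) (1 < h)%N%:R * t ^+ h)).
  rewrite 2!big_ord_recr /= -addrA lerDl addr_ge0 // mulr_ge0 ?exprn_ge0 //.
rewrite 2!big_ord_recl /= mul0r mul0r !add0r.
have -> : \sum_(i < N) (1 < lift ord0 (lift ord0 i))%N%:R *
      t ^+ (lift ord0 (lift ord0 i)) =
    t * \sum_(i < N) t ^+ i.+1.
  by rewrite mulr_sumr; apply: eq_bigr => i _; rewrite !lift0 mul1r exprS.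
have := geometric_sum_le N tP; rewrite expr2; nra.
Qed.

Lemma cubic_geometric_sum_le n :
  \sum_(r < n) 2^-1 ^+ r * (r.+1%:R ^+ 2 * r.+2%:R) <= 64 :> R.
Proof.
(* The closed form shows that [64] is the value of the full series. *)
suff -> : \sum_(r < n) 2^-1 ^+ r * (r.+1%:R ^+ 2 * r.+2%:R) =
  64 - (2 * n%:R ^+ 3 + 14 * n%:R ^+ 2 + 44 * n%:R + 64) * 2^-1 ^+ n :> R.
  by rewrite lerBlDr lerDl mulr_ge0 ?exprn_ge0 ?invr_ge0 //.
elim: n => [|n IHn]; first by rewrite big_ord0 expr0; lra.
rewrite big_ord_recr /= {}IHn [2^-1 ^+ n.+1]exprS -[n.+2%:R]natr1 -[n.+1%:R]natr1.
by move: (2^-1 ^+ n) => a; lra.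
Qed.

Lemma ln_lower x : 0 < x -> 1 - x^-1 <= ln x.
Proof.
move=> x0; have : ln x^-1 <= x^-1 - 1.
  have := @le_ln1Dx R (x^-1 - 1); rewrite subrKC; apply.
  by rewrite ltrBrDl subrr invr_gt0.
by rewrite lnV ?posrE //; lra.
Qed.

Lemma ln_upper x : 0 < x -> ln x <= x - 1.
Proof.
by move=> x0; have := @le_ln1Dx R (x - 1); rewrite subrKC; apply; rewrite ltrBrDl subrr.
Qed.

Lemma lnS l : ln l.+2%:R = ln l.+1%:R + ln (l.+2%:R / l.+1%:R) :> R.
Proof. by rewrite ln_div ?posrE ?ltr0n // addrC subrK. Qed.

Lemma harmonic_ge l : (0 < l)%N -> ln l%:R <= \sum_(k < l) k.+1%:R^-1 :> R.
Proof.
(* The induction needs [ln (l + 1)], whose increment [ln ((l + 2) / (l + 1))] is at most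
   [1 / (l + 1)]. *)
move=> l0; apply: (@le_trans _ _ (ln l.+1%:R)).
  by rewrite ler_ln ?posrE ?ltr0n // ler_nat.
elim: l {l0} => [|l IHl]; first by rewrite big_ord0 ln1.
rewrite big_ord_recr lnS /= lerD // (le_trans (ln_upper _)) ?divr_gt0 ?ltr0n //.
by rewrite -[l.+2%:R]natr1 mulrDl mulfV ?pnatr_eq0 // mul1r addrC addKr.
Qed.

Lemma harmonic_le l : (0 < l)%N -> \sum_(k < l) k.+1%:R^-1 <= 1 + ln l%:R :> R.
Proof.
case: l => // l _; elim: l => [|l IHl].
  by rewrite big_ord1 ln1 invr1 addr0.
rewrite big_ord_recr lnS /= addrA lerD // (le_trans _ (ln_lower _)) ?divr_gt0 ?ltr0n //.
rewrite invf_div -[l.+1%:R](addrK 1) natr1 mulrBl mulfV ?pnatr_eq0 //.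
by rewrite opprB addrC subrK mul1r.
Qed.

Lemma sum_inv_square_le l : \sum_(k < l) (k.+1%:R ^+ 2)^-1 <= 2 :> R.
Proof.
(* The subtracted [1 / (l + 1)] telescopes: [1 / (a + 1)^2 <= 1 / a - 1 / (a + 1)]. *)
suff : \sum_(k < l.+1) (k.+1%:R ^+ 2)^-1 <= 2 - l.+1%:R^-1 :> R.
  move=> H; apply: (@le_trans _ _ (2 - l.+1%:R^-1)); last by rewrite gerBl invr_ge0.
  by apply: le_trans H; rewrite big_ord_recr lerDl invr_ge0 exprn_ge0.
elim: l => [|l IHl]; first by rewrite big_ord1 expr1n invr1; lra.
rewrite big_ord_recr /=.
have a0 : 0 < l.+1%:R :> R by rewrite ltr0n.
have : (l.+2%:R ^+ 2)^-1 <= l.+1%:R^-1 - l.+2%:R^-1 :> R; last first.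
  by move=> H; apply: le_trans (lerD IHl H) _; rewrite addrA subrK.
rewrite -[l.+2%:R]natr1; move: (l.+1%:R) a0 => a a0.
rewrite -subr_ge0.
have -> : a^-1 - (a + 1)^-1 - ((a + 1) ^+ 2)^-1 = a^-1 * ((a + 1) ^+ 2)^-1.
  by field; lra.
by rewrite mulr_ge0 // invr_ge0 ?exprn_ge0 //; lra.
Qed.

Lemma sum_inv_cube_le l : \sum_(k < l) (k.+1%:R ^+ 3)^-1 <= 2 :> R.
Proof.
apply: le_trans (sum_inv_square_le l); apply: ler_sum => k _.
rewrite lef_pV2 ?posrE ?exprn_gt0 ?ltr0n // ler_weXn2l // ler1n //.
Qed.
End ElementarySums.

(** * The mean as a sum over irreducible polynomials *)

Section Truncations.
Variable F : finFieldType.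
Implicit Types (b : {poly F}).
Local Notation q := #|F|.

Lemma size_monic_irr d : size (monic_irr F d) =
  #|[set f : {poly_d.+1 F} |
    [&& `[< irreducible_poly f >], polyn f \is monic & size f == d.+1]]|.
Proof.
rewrite size_map cardE; apply: perm_size; apply: uniq_perm.
- exact/filter_uniq/enum_uniq.
- exact: enum_uniq.
- by move=> f; rewrite mem_filter !mem_enum finset.in_set; exact: andbT.
Qed.

Lemma monic_irr0 : size (monic_irr F 0) = 0%N.
Proof.
apply/eqP; rewrite size_eq0; apply/eqP; case E : (monic_irr F 0) => [//|p s].
have /monic_irrP[[[p1 _] _] sp] : p \in monic_irr F 0 by rewrite E mem_head.
by rewrite sp in p1.
Qed.

(** Puts [g] in a type independent of [f], so that the sums over [f] and [g] can be exchanged. *)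
Lemma truncLE b (f : {poly F}) n : (size f <= n)%N ->
  truncL b f = #|[set g : {poly_n F} | [&& (size g <= size f)%N,
    `[< irreducible_poly g >] &
    b ^+ ((size g).-1 %/ (size b).-1).+1 %| (g : {poly F}) - f]]|.
Proof.
move=> fn.
have phiE (g : {poly_(size f) F}) : npolyp n g = g :> {poly F}.
  by rewrite npolypK // (leq_trans (size_npoly g)).
rewrite /truncL -(card_imset _ (f := fun g : {poly_(size f) F} => npolyp n g)); last first.
  by move=> g h /(congr1 val); rewrite /= !phiE => /val_inj.
apply: eq_card => g; rewrite finset.inE; apply/imsetP/and3P => [[h + ->]|[gf gI gd]].
  by rewrite finset.inE phiE => /andP[]; rewrite size_npoly.
exists (npolyp (size f) g); last by apply/val_inj; rewrite /= phiE npolypK.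
by rewrite finset.inE npolypK // gI.
Qed.

(** The polynomials counted are [g + B * u] with [u] of degree below [N - deg B]. The size condition
    is then automatic: [u = 0] gives [g] itself, and any other [u] gives a larger size. *)
Lemma card_congruent (B g : {poly F}) N : (size g < size B)%N ->
  ((size B).-1 <= N)%N ->
  #|[set f : {poly_N F} | (size g <= size f)%N && (B %| g - f)]| =
  (q ^ (N - (size B).-1))%N.
Proof.
move=> gB BN; set D := (size B).-1.
have sB : size B = D.+1 by rewrite /D; case: (size B) gB.
have gD : (size g <= D)%N by rewrite -ltnS -sB.
have B0 : B != 0 by rewrite -size_poly_eq0 sB.
have phiE (u : {poly_(N - D) F}) : npolyp N (g + B * u) = g + B * u :> {poly F}.
  rewrite npolypK // (leq_trans (size_polyD _ _)) // geq_max.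
  rewrite (leq_trans gD BN) /=.
  rewrite (leq_trans (size_polyMleq _ _)) // sB.
  by have := size_npoly u; move: (size u) => x; lia.
rewrite -card_npoly -cardsT.
rewrite -(card_imset _ (f := fun u : {poly_(N - D) F} => npolyp N (g + B * u))); last first.
  move=> u v /(congr1 val); rewrite /= !phiE => /addrI /(mulfI B0).
  exact: val_inj.
apply: eq_card => f; rewrite finset.inE; apply/andP/imsetP => [[gf]|[u _ ->]].
  rewrite -dvdpNr opprB => /dvdpP[u fE].
  have sfg : (size ((f : {poly F}) - g)%R <= N)%N.
    rewrite (leq_trans (size_polyD _ _)) // geq_max size_npoly size_polyN.
    by rewrite (leq_trans gf) ?size_npoly.
  have su : (size u <= N - D)%N.
    have [->|u0] := eqVneq u 0; first by rewrite size_poly0.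
    by move: sfg; rewrite fE size_mul // sB; move: (size u) => x; lia.
  exists (npolyp (N - D) u) => //; apply/val_inj; rewrite /= phiE npolypK //.
  by rewrite mulrC -fE addrC subrK.
rewrite phiE; split; last first.
  rewrite -[X in B %| _ - X]/(polyn (npolyp N (g + B * u))) phiE.
  by rewrite opprD addNKr dvdpNr dvdp_mulr.
have [->|u0] := eqVneq (u : {poly F}) 0; first by rewrite mulr0 addr0.
have sBu : (size g < size (B * (u : {poly F}))%R)%N.
  rewrite (leq_trans gB) // size_mul // sB; rewrite -size_poly_gt0 in u0.
  by move: u0; move: (size (u : {poly F})) => x; lia.
by rewrite addrC size_polyDl // ltnW.
Qed.

(** An irreducible polynomial is uniquely a nonzero constant times a monic irreducible one. *)
Lemma card_irreducible d N : (d < N)%N ->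
  #|[set g : {poly_N F} | `[< irreducible_poly g >] && (size g == d.+1)]| =
  (q.-1 * size (monic_irr F d))%N.
Proof.
move=> dN; rewrite size_monic_irr; set S := [set f | _].
have -> : q.-1 = #|[set c : F | c != 0]|.
  by rewrite -(cardC1 (0 : F)); apply: eq_card => c; rewrite !finset.inE.
have phiE (x : F * {poly_d.+1 F}) :
    npolyp N (x.1 *: (x.2 : {poly F})) = x.1 *: (x.2 : {poly F}) :> {poly F}.
  by rewrite npolypK // (leq_trans (size_scale_leq _ _)) // (leq_trans (size_npoly _)).
rewrite -cardsX -(card_in_imset (f := fun x : F * {poly_d.+1 F} =>
  npolyp N (x.1 *: (x.2 : {poly F})))); last first.
  move=> [c p] [c' p']; rewrite !finset.inE /= => /andP[c0 /and3P[_ pM _]].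
  move=> /andP[c'0 /and3P[_ p'M _]] /(congr1 val).
  rewrite /= (phiE (c, p)) (phiE (c', p')) /= => E.
  have cE : c = c'.
    by have := congr1 lead_coef E; rewrite !lead_coefZ (monicP pM) (monicP p'M) !mulr1.
  by move: E; rewrite cE => /(scalerI c'0)/val_inj->.
apply: eq_card => g; rewrite finset.inE; apply/andP/imsetP => [[/asboolP gI sg]|[[c p]]].
  have g0 : (g : {poly F}) != 0 by exact: irredp_neq0.
  set c := lead_coef g; have c0 : c != 0 by rewrite lead_coef_eq0.
  have ci0 : c^-1 != 0 by rewrite invr_eq0.
  have sp : size (c^-1 *: (g : {poly F})) = d.+1 by rewrite size_scale // (eqP sg).
  have pE : npolyp d.+1 (c^-1 *: (g : {poly F})) = c^-1 *: (g : {poly F}) :> {poly F}.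
    by rewrite npolypK ?sp.
  exists (c, npolyp d.+1 (c^-1 *: (g : {poly F}))); last first.
    by apply/val_inj; rewrite /= (phiE (_, _)) /= pE scalerA mulfV // scale1r.
  rewrite !finset.inE /= c0 pE sp eqxx monicE lead_coefZ mulVf // eqxx !andbT /=.
  apply/asboolP; split=> [|u u1]; first by rewrite size_scale // (eqP sg) -(eqP sg) gI.1.
  rewrite dvdpZr // => /(gI.2 _ u1) ug.
  by rewrite (eqp_trans ug) // eqp_sym eqp_scale.
rewrite !finset.inE /= => /andP[c0 /and3P[/asboolP pI pM /eqP sp]] ->.
rewrite (phiE (_, _)) /= size_scale // sp eqxx; split=> //.
apply/asboolP; split=> [|u u1]; first by rewrite size_scale // pI.1.
rewrite dvdpZr // => /(pI.2 _ u1) up.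
by rewrite (eqp_trans up) // eqp_sym eqp_scale.
Qed.

(** Double counting of the pairs [(f, g)]: [card_congruent] counts the [f] for fixed [g], and the
    [g] are then grouped by degree [h]. *)
Lemma sum_truncL b m l : size b = m.+1 -> (0 < m)%N ->
  (\sum_(f : {poly_(m * l) F}) truncL b f =
   \sum_(h < m * l) q.-1 * size (monic_irr F h) * q ^ (m * l - m * (h %/ m).+1))%N.
Proof.
move=> sb m0; set N := (m * l)%N.
have b0 : b != 0 by rewrite -size_poly_eq0 sb.
pose P (g f : {poly_N F}) := (size g <= size f)%N &&
  (b ^+ ((size g).-1 %/ m).+1 %| (g : {poly F}) - f).
have -> : (\sum_(f : {poly_N F}) truncL b f =
   \sum_(g : {poly_N F} | `[< irreducible_poly g >]) #|[set f | P g f]|)%N.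
  under eq_bigr => f _ do rewrite (truncLE b (size_npoly f)) -sum1dep_card sb /=.
  under [RHS]eq_bigr => g _ do rewrite -sum1dep_card.
  rewrite (exchange_big_dep (fun g : {poly_N F} => `[< irreducible_poly g >])) /=.
    apply: eq_bigr => g gI; apply: eq_bigl => f; by rewrite /P gI.
  by move=> f g _ /and3P[].
have cP (g : {poly_N F}) : irreducible_poly g ->
    #|[set f | P g f]| = (q ^ (N - m * ((size g).-1 %/ m).+1))%N.
  move=> gI; have sB k : size (b ^+ k) = (m * k).+1.
    have := size_exp b k; rewrite sb /=.
    by case: (size _) (size_poly_gt0 (b ^+ k)); rewrite expf_neq0 // => k' _ /= ->.
  have g1 := gI.1; have gN := size_npoly g.
  rewrite card_congruent !sB //=.
    by rewrite ltnS; move: (size g) g1 gN => x; nia.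
  by rewrite leq_mul2l; move: (size g) g1 gN => x; nia.
under eq_bigr => g /asboolP gI do rewrite cP //.
have [N0|N0] := posnP N.
  rewrite N0 big_ord0 big1 // => g /asboolP[]; have := size_npoly g.
  by case: size.
have hN (g : {poly_N F}) : ((size g).-1 < N)%N.
  by have := size_npoly g; move: (size g) => x; lia.
rewrite (partition_big (fun g : {poly_N F} => Ordinal (hN g)) xpredT) //=.
apply: eq_bigr => h _; rewrite -(card_irreducible (ltn_ord h)).
rewrite (eq_bigr (fun=> q ^ (N - m * (h %/ m).+1))%N); last first.
  by move=> g /andP[_ /eqP <-].
rewrite sum_nat_const; congr (_ * _)%N; apply: eq_card => g.
rewrite [LHS]unfold_in finset.inE.
case: asboolP => //= gI; rewrite -val_eqE /=; have := gI.1.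
by case: (size g).
Qed.
End Truncations.

Lemma mean_truncLE (R : realType) (F : finFieldType) (b : {poly F}) m l :
  size b = m.+1 -> (0 < m)%N ->
  mean_truncL R b l = \sum_(k < l) \sum_(r < m)
    (#|F|%:R - 1) * (size (monic_irr F (m * k.+1 - r.+1)))%:R
      / #|F|%:R ^+ (m * k.+1).
Proof.
move=> sb m0; rewrite /mean_truncL sb /= -natr_sum sum_truncL //.
have q0 : #|F|%:R != 0 :> R by rewrite pnatr_eq0 -lt0n ltnW // finNzRing_gt1.
rewrite natr_sum mulr_sumr.
pose G h : R := (#|F|%:R - 1) * (size (monic_irr F h))%:R / #|F|%:R ^+ (m * (h %/ m).+1).
transitivity (\sum_(h < m * l) G h).
  apply: eq_bigr => h _; rewrite /G !natrM natrX -subn1 (natrB _ (ltnW (finNzRing_gt1 F))).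
  rewrite mulrC -!mulrA; congr (_ * (_ * _)).
  (* The natural subtraction in the exponent is thus genuine, and the powers of [q] cancel
     exactly. *)
  have hl : (m * (h %/ m).+1 <= m * l)%N.
    by rewrite leq_mul2l ltn_divLR // [(l * m)%N]mulnC ltn_ord orbT.
  by rewrite -[X in _ / _ ^+ X](subnK hl) exprD invfM mulVKf // expf_neq0.
rewrite sum_blocks; apply: eq_bigr => k _; apply: eq_bigr => r _; rewrite /G.
by have -> : ((m * k.+1 - r.+1) %/ m = k)%N by have := ltn_ord r; nia.
Qed.

(** * Comparison with the sum of [w_r / (m k - r)] *)

Section InverseDifference.
Variable R : realType.
Implicit Types (x y : R) (m k r : nat).

(* The alternative [i = 0] is the junk value [0^-1] taken at [x = y]. *)
Definition inv_diff x y i := (i = 0 /\ x = y) \/ (1 <= x - y /\ i = (x - y)^-1).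

Lemma inv_diff_nat m k r : (r < m)%N ->
  inv_diff (m * k.+1)%:R r.+1%:R (m * k.+1 - r.+1)%:R^-1.
Proof.
move=> rm; have rx : (r < m * k.+1)%N by rewrite (leq_trans rm) // leq_pmulr.
have hE : (m * k.+1 - r.+1)%:R = (m * k.+1)%:R - r.+1%:R :> R by rewrite natrB.
have [h0|h0] := posnP (m * k.+1 - r.+1); [left|right].
  split; first by rewrite h0 invr0.
  by apply/eqP; rewrite -subr_eq0 -hE h0.
by rewrite -hE ler1n.
Qed.

(** The ratio is [1 + y / (x - y)], with denominator at least [1]. *)
Lemma ratio_le x y : 1 <= y -> 1 <= x - y -> 0 <= x / (x - y) <= y + 1.
Proof.
move=> y1 xy; have d0 : 0 < x - y by lra.
by rewrite divr_ge0 ?ler_pdivrMr //; nra.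
Qed.

Lemma inv_diff_le x y i : 1 <= y -> y <= x -> inv_diff x y i -> i <= (y + 1) / x.
Proof.
move=> y1 yx; have x0 : 0 < x by lra.
case=> [[-> _]|[xy ->]]; first by rewrite divr_ge0 //; lra.
have d0 : 0 < x - y by lra.
by rewrite ler_pdivlMr // mulrC; have /andP[] := ratio_le y1 xy.
Qed.

(** The difference times [x^2] is [y * (x / (x - y))], or [- y] in the junk case. The bound is
    stated with [y^2 * (y + 1)] so that one cubic moment of the weights serves both orders. *)
Lemma inv_diff_order1 x y i : 1 <= y -> y <= x -> inv_diff x y i ->
  `|i - x^-1| <= y ^+ 2 * (y + 1) / x ^+ 2.
Proof.
move=> y1 yx; have x0 : 0 < x by lra.
have x2 : 0 < x ^+ 2 by rewrite exprn_gt0.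
rewrite ler_pdivlMr // -(ger0_norm (ltW x2)) -normrM.
case=> [[-> xy]|[xy ->]].
  rewrite (_ : _ * _ = - x); last by field; lra.
  by rewrite normrN ger0_norm ?ltW // xy; nra.
have -> : ((x - y)^-1 - x^-1) * x ^+ 2 = y * (x / (x - y)).
  by field; rewrite !gt_eqF //; lra.
have /andP[] := ratio_le y1 xy; move: (x / _) => c c0 c1.
rewrite ger0_norm; last by nra.
by apply: (@le_trans _ _ (y * (y + 1))); nra.
Qed.

(** The remainder times [x^3] is [y^2 * (x / (x - y))], or [- 2 * y^2] in the junk case. *)
Lemma inv_diff_order2 x y i : 1 <= y -> y <= x -> inv_diff x y i ->
  `|i - x^-1 - y / x ^+ 2| <= 2 * (y ^+ 2 * (y + 1)) / x ^+ 3.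
Proof.
move=> y1 yx; have x0 : 0 < x by lra.
have x3 : 0 < x ^+ 3 by rewrite exprn_gt0.
rewrite ler_pdivlMr // -(ger0_norm (ltW x3)) -normrM.
have yy : 0 <= y ^+ 2 by rewrite exprn_ge0 //; lra.
case=> [[-> xy]|[xy ->]].
  rewrite (_ : _ * _ = - (2 * y ^+ 2)); last by rewrite xy; field; lra.
  by rewrite normrN ger0_norm; nra.
have -> : ((x - y)^-1 - x^-1 - y / x ^+ 2) * x ^+ 3 = y ^+ 2 * (x / (x - y)).
  by field; rewrite !gt_eqF //; lra.
have /andP[] := ratio_le y1 xy; move: (x / _) => c c0 c1.
by rewrite ger0_norm; nra.
Qed.
End InverseDifference.

(** * Moments of the geometric weights *)

Section Weights.
Variables (R : realType) (q : nat).
Hypothesis q_gt1 : (1 < q)%N.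
Implicit Types (k l m r : nat).
Local Notation Q := (q%:R : R).

Let Q_ge2 : 2 <= Q. Proof. by rewrite ler_nat. Qed.
Let Q_gt0 : 0 < Q. Proof. by rewrite ltr0n (ltn_trans _ q_gt1). Qed.
Let Q_neq0 : Q != 0. Proof. by rewrite gt_eqF. Qed.

(* Indices are shifted: [weight r] is [w_(r+1)]. *)
Definition weight r : R := (Q - 1) / Q ^+ r.+1.

Lemma weight_ge0 r : 0 <= weight r.
Proof. by rewrite /weight divr_ge0 ?exprn_ge0//; have := Q_ge2; lra. Qed.

Lemma weight_le r : weight r <= 2^-1 ^+ r.
Proof.
rewrite /weight exprS invfM mulrA.
apply: (@le_trans _ _ (1 * (Q ^+ r)^-1)).
  rewrite ler_wpM2r ?invr_ge0 ?exprn_ge0//.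
  by rewrite ler_pdivrMr // mul1r; have := Q_ge2; lra.
by rewrite mul1r exprVn lef_pV2 ?posrE ?exprn_gt0 // lerXn2r ?nnegrE.
Qed.

(** All weights but the first carry an additional [1 / Q]; the right side is shaped to match the
    cubic series at index [r.+1]. *)
Lemma weightS_le r : weight r.+1 <= 2 / Q * 2^-1 ^+ r.+1.
Proof.
rewrite /weight exprS invfM mulrA mulrAC.
have := weight_le r; rewrite /weight => H.
rewrite (_ : 2 / Q * 2^-1 ^+ r.+1 = 2^-1 ^+ r / Q).
  by rewrite ler_wpM2r // invr_ge0.
by rewrite exprS; move: (2^-1 ^+ r) => a; field.
Qed.

Lemma sum_weight m : \sum_(r < m) weight r = 1 - (Q ^+ m)^-1.
Proof.
elim: m => [|m IHm]; first by rewrite big_ord0 expr0 invr1 subrr.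
rewrite big_ord_recr /= {}IHm /weight exprS invfM.
have : Q ^+ m != 0 by rewrite expf_neq0.
by move: (Q ^+ m) => a a0; field; rewrite a0 Q_neq0.
Qed.

(** The weights are the geometric distribution with success probability [1 - 1 / Q], whose mean is
    [Q / (Q - 1)]; the subtracted term is the tail beyond [m]. *)
Lemma sum_weight_linear m : \sum_(r < m) weight r * r.+1%:R =
  Q / (Q - 1) - (Q ^+ m)^-1 * (m%:R + Q / (Q - 1)).
Proof.
have Q1 : Q - 1 != 0 by rewrite gt_eqF //; have := Q_ge2; lra.
elim: m => [|m IHm].
  by rewrite big_ord0 expr0 invr1 mul1r add0r subrr.
rewrite big_ord_recr /= {}IHm /weight exprS invfM.
have : Q ^+ m != 0 by rewrite expf_neq0.
rewrite -[m.+1%:R]natr1; move: (Q ^+ m) m%:R => a x a0.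
by field; rewrite a0 Q_neq0 Q1.
Qed.

Lemma sum_weight_cubic_le m :
  \sum_(r < m) weight r * (r.+1%:R ^+ 2 * r.+2%:R) <= 64.
Proof.
apply: le_trans (cubic_geometric_sum_le R m); apply: ler_sum => r _.
by rewrite ler_wpM2r ?mulr_ge0 ?exprn_ge0 // weight_le.
Qed.

(** [weightS_le] supplies the factor [2 / Q], and enlarging [r.+2] to the cubic weight gives
    [128 = 2 * 64]. *)
Lemma sum_weight_tail_le m :
  \sum_(r < m | (0 < r)%N) weight r * r.+2%:R <= 128 / Q.
Proof.
apply: (@le_trans _ _ (2 / Q * \sum_(r < m) 2^-1 ^+ r * (r.+1%:R ^+ 2 * r.+2%:R))).
  rewrite mulr_sumr [leRHS](bigID (fun r : 'I_m => (0 < r)%N)) /=.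
  rewrite -[leLHS]addr0 lerD //; last first.
    apply: sumr_ge0 => r _.
    by rewrite mulr_ge0 ?divr_ge0 ?mulr_ge0 ?exprn_ge0 ?invr_ge0 //.
  apply: ler_sum => -[[|r] rm] //= _.
  rewrite mulrA; apply: ler_pM; rewrite ?weight_ge0 ?weightS_le //.
  rewrite ler_peMl // -natrX ler1n expn_gt0 //.
rewrite (_ : 128 / Q = 2 / Q * 64); last by field.
by rewrite ler_wpM2l ?cubic_geometric_sum_le // divr_ge0 //.
Qed.

(* At [k = 0], [r = m - 1] the summand is [0], as [0^-1 = 0]. *)
Definition approx m l : R :=
  \sum_(k < l) \sum_(r < m) weight r / (m * k.+1 - r.+1)%:R.

End Weights.

(** * Expansions of the weighted sum *)

Section Approximation.
Variables (R : realType) (q : nat).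
Hypothesis q_gt1 : (1 < q)%N.
Implicit Types (k l m r : nat).
Local Notation Q := (q%:R : R).
Local Notation w := (weight R q).

Let Q_ge2 : 2 <= Q. Proof. by rewrite ler_nat. Qed.
Let Q_gt0 : 0 < Q. Proof. by rewrite ltr0n (ltn_trans _ q_gt1). Qed.
Let Q_neq0 : Q != 0. Proof. by rewrite gt_eqF. Qed.

Lemma weighted_error_le (D : nat -> nat -> R) (c : nat -> R) m l :
  (forall k, 0 <= c k) ->
  (forall k r, (r < m)%N -> `|D k r| <= r.+1%:R ^+ 2 * r.+2%:R * c k) ->
  `|\sum_(k < l) \sum_(r < m) w r * D k r| <= 64 * \sum_(k < l) c k.
Proof.
move=> c0 Dc; rewrite mulr_sumr (le_trans (ler_norm_sum _ _ _)) //.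
apply: ler_sum => k _; rewrite (le_trans (ler_norm_sum _ _ _)) //.
apply: le_trans (ler_wpM2r (c0 k) (sum_weight_cubic_le R q_gt1 m)).
rewrite mulr_suml; apply: ler_sum => r _.
by rewrite normrM ger0_norm ?weight_ge0 // -[leRHS]mulrA ler_wpM2l ?weight_ge0 // Dc.
Qed.

Let bounds k m r : (r < m)%N -> 1 <= r.+1%:R :> R /\ r.+1%:R <= (m * k.+1)%:R :> R.
Proof. by move=> rm; rewrite ler1n ler_nat (leq_trans rm) // leq_pmulr. Qed.

Lemma inv_block m k : (m * k.+1)%:R^-1 = m%:R^-1 * k.+1%:R^-1 :> R.
Proof. by rewrite natrM invfM. Qed.

(** Replaces [1 / (m k - r)] by [1 / (m k)]; the constant is [64 * 2], from the cubic moment and the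
    sum of inverse squares. *)
Lemma approx_order1 m l : (0 < m)%N ->
  `|approx R q m l - (1 - (Q ^+ m)^-1) / m%:R * \sum_(k < l) k.+1%:R^-1|
  <= 128 / m%:R ^+ 2.
Proof.
move=> m0.
have -> : approx R q m l - (1 - (Q ^+ m)^-1) / m%:R * \sum_(k < l) k.+1%:R^-1 =
    \sum_(k < l) \sum_(r < m) w r * ((m * k.+1 - r.+1)%:R^-1 - (m * k.+1)%:R^-1).
  rewrite -(sum_weight R q_gt1) mulr_sumr -sumrB; apply: eq_bigr => k _.
  rewrite -mulrA -inv_block mulr_suml -sumrB; apply: eq_bigr => r _.
  by rewrite mulrBr.
apply: le_trans (weighted_error_le l (c := fun k => ((m * k.+1)%:R ^+ 2)^-1)
  (D := fun k r => (m * k.+1 - r.+1)%:R^-1 - (m * k.+1)%:R^-1) _ _) _.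
- by move=> k; rewrite invr_ge0 exprn_ge0.
- move=> k r rm; have [r1 rk] := bounds k rm.
  by have := inv_diff_order1 r1 rk (inv_diff_nat R k rm); rewrite natr1.
have -> : \sum_(k < l) ((m * k.+1)%:R ^+ 2)^-1 =
    (m%:R ^+ 2)^-1 * \sum_(k < l) (k.+1%:R ^+ 2)^-1 :> R.
  by rewrite mulr_sumr; apply: eq_bigr => k _; rewrite natrM exprMn invfM.
have := sum_inv_square_le R l; have : 0 <= (m%:R ^+ 2)^-1 :> R.
  by rewrite invr_ge0 exprn_ge0.
move: (_^-1) (\sum_(k < l) _) => a z a0 z2; nra.
Qed.

(** The zeroth and first moments of the weights give the two main terms; the constant is
    [64 * 2 * 2]. *)
Lemma approx_order2 m l : (0 < m)%N ->
  `|approx R q m l - ((1 - (Q ^+ m)^-1) / m%:R * \sum_(k < l) k.+1%:R^-1 +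
     (Q / (Q - 1) - (Q ^+ m)^-1 * (m%:R + Q / (Q - 1))) / m%:R ^+ 2
       * \sum_(k < l) (k.+1%:R ^+ 2)^-1)|
  <= 256 / m%:R ^+ 3.
Proof.
move=> m0.
have -> : approx R q m l - ((1 - (Q ^+ m)^-1) / m%:R * \sum_(k < l) k.+1%:R^-1 +
     (Q / (Q - 1) - (Q ^+ m)^-1 * (m%:R + Q / (Q - 1))) / m%:R ^+ 2
       * \sum_(k < l) (k.+1%:R ^+ 2)^-1) =
    \sum_(k < l) \sum_(r < m) w r *
      ((m * k.+1 - r.+1)%:R^-1 - (m * k.+1)%:R^-1 - r.+1%:R / (m * k.+1)%:R ^+ 2).
  rewrite -(sum_weight R q_gt1) -(sum_weight_linear R q_gt1).
  rewrite !mulr_sumr -big_split /= -sumrB; apply: eq_bigr => k _.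
  rewrite -mulrA -inv_block -[_ / _ / _]mulrA -invfM -exprMn -natrM.
  rewrite !mulr_suml -big_split /= -sumrB; apply: eq_bigr => r _.
  by rewrite !mulrBr opprD !addrA !mulrA.
apply: le_trans (weighted_error_le l (c := fun k => 2 / (m * k.+1)%:R ^+ 3)
  (D := fun k r => (m * k.+1 - r.+1)%:R^-1 - (m * k.+1)%:R^-1
    - r.+1%:R / (m * k.+1)%:R ^+ 2) _ _) _.
- by move=> k; rewrite divr_ge0 ?exprn_ge0.
- move=> k r rm; have [r1 rk] := bounds k rm.
  have := inv_diff_order2 r1 rk (inv_diff_nat R k rm); rewrite natr1.
  by rewrite [2 * _]mulrC -[X in _ <= X -> _]mulrA.
have -> : \sum_(k < l) (2 / (m * k.+1)%:R ^+ 3) =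
    (m%:R ^+ 3)^-1 * (2 * \sum_(k < l) (k.+1%:R ^+ 3)^-1) :> R.
  rewrite mulrCA !mulr_sumr; apply: eq_bigr => k _.
  by rewrite natrM exprMn invfM.
have := sum_inv_cube_le R l; have : 0 <= (m%:R ^+ 3)^-1 :> R.
  by rewrite invr_ge0 exprn_ge0.
move: (_^-1) (\sum_(k < l) _) => a z a0 z2; nra.
Qed.

(** In each block the first weight is [1 - 1 / Q]. Replacing it by [1] costs [2 / (Q x)] and
    dropping the other weights costs [128 / (Q x)], where [x = m * k.+1]. *)
Lemma approx_leading m l : (0 < m)%N ->
  `|approx R q m l - \sum_(k < l) (m * k.+1 - 1)%:R^-1|
  <= 130 / Q / m%:R * \sum_(k < l) k.+1%:R^-1.
Proof.
case: m => // m _; rewrite /approx -sumrB mulr_sumr.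
rewrite (le_trans (ler_norm_sum _ _ _)) //; apply: ler_sum => k _.
rewrite -mulrA -inv_block; set x := (m.+1 * k.+1)%:R.
have x0 : 0 < x by rewrite ltr0n.
have inv_le r : (r < m.+1)%N -> (m.+1 * k.+1 - r.+1)%:R^-1 <= r.+2%:R / x.
  move=> rm; have [r1 rk] := bounds k rm.
  by have := inv_diff_le r1 rk (inv_diff_nat R k rm); rewrite natr1.
rewrite (bigD1 ord0) //=.
set A := \sum_(r < m.+1 | _) _.
have A0 : 0 <= A.
  by apply: sumr_ge0 => r _; rewrite divr_ge0 ?weight_ge0.
have A1 : A <= 128 / Q / x.
  apply: le_trans (_ : \sum_(r < m.+1 | (0 < r)%N) w r * r.+2%:R / x <= _).
    rewrite /A (eq_bigl (fun r : 'I_m.+1 => (0 < r)%N)); last first.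
      by move=> r; rewrite lt0n.
    apply: ler_sum => r _; rewrite -mulrA ler_wpM2l ?weight_ge0 //.
    exact: inv_le.
  by rewrite -mulr_suml ler_wpM2r ?invr_ge0 ?(ltW x0) // sum_weight_tail_le.
have w0 : w 0 = 1 - Q^-1 by rewrite /weight expr1 mulrBl mulfV ?mul1r.
rewrite w0.
have B := inv_le 0%N isT; set i := (_ - 1)%:R^-1 in B *.
have i0 : 0 <= i by rewrite invr_ge0.
have -> : (1 - Q^-1) * i + A - i = A - Q^-1 * i by ring.
rewrite ler_norml.
have B1 : Q^-1 * i <= 2 / Q / x.
  rewrite -[2 / Q]mulrC -mulrA ler_wpM2l ?invr_ge0 //.
have B0 : 0 <= Q^-1 * i by rewrite mulr_ge0 ?invr_ge0.
have -> : 130 / Q / x = 2 / Q / x + 128 / Q / x.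
  by rewrite -!mulrDl; congr (_ / _ / _); lra.
move: A0 A1 B1 B0; move: (2 / Q / x) (128 / Q / x) (Q^-1 * i) => a b c; lra.
Qed.
End Approximation.

(** * Cost of replacing the prime polynomial count by [q^h / h] *)

Section PrimeCountError.
Variables (R : realType) (q : nat) (P : nat -> nat).
Hypothesis q_gt1 : (1 < q)%N.
Hypothesis P0 : P 0 = 0%N.
Hypothesis P_upper : forall n, (0 < n)%N -> (n * P n <= q ^ n)%N.
Hypothesis P_lower : forall n, (0 < n)%N ->
  (q ^ n <= n * P n + (1 < n) * (2 * q ^ (n %/ 2)))%N.
Implicit Types (k l m r h : nat).
Local Notation Q := (q%:R : R).
Local Notation w := (weight R q).
Local Notation s := (Num.sqrt Q).

Let Q_ge2 : 2 <= Q. Proof. by rewrite ler_nat. Qed.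
Let Q_gt0 : 0 < Q. Proof. by rewrite ltr0n (ltn_trans _ q_gt1). Qed.
Let Q_neq0 : Q != 0. Proof. by rewrite gt_eqF. Qed.
Let s_gt0 : 0 < s. Proof. by rewrite sqrtr_gt0. Qed.
Let s_neq0 : s != 0. Proof. by rewrite gt_eqF. Qed.
Let s2 : s ^+ 2 = Q. Proof. by rewrite sqr_sqrtr. Qed.

Lemma sqrt_ge1 : 1 <= s.
Proof. by rewrite -[leLHS]sqrtr1 ler_sqrt //; have := Q_ge2; lra. Qed.

Lemma sqrt_inv_le : 0 <= s^-1 <= 3 / 4.
Proof.
rewrite invr_ge0 (ltW s_gt0) /= -[s^-1]mul1r ler_pdivrMr //.
(* [s >= 4 / 3] because [(4 / 3)^2 = 16 / 9 < 2]. *)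
have : 2 <= s ^+ 2 by rewrite s2.
by move: s_gt0; move: s => x x0; nra.
Qed.

Lemma count_defect h : (0 < h)%N ->
  0 <= Q ^+ h / h%:R - (P h)%:R <= (1 < h)%N%:R * (2 * s ^+ h).
Proof.
move=> h0; have hR : 0 < h%:R :> R by rewrite ltr0n.
have h1 : 1 <= h%:R :> R by rewrite ler1n.
have U : h%:R * (P h)%:R <= Q ^+ h by rewrite -natrM -natrX ler_nat P_upper.
have L : Q ^+ h <= h%:R * (P h)%:R + (1 < h)%N%:R * (2 * Q ^+ (h %/ 2)).
  by rewrite -!natrX -!natrM -natrD ler_nat P_lower.
have S : Q ^+ (h %/ 2) <= s ^+ h.
  by rewrite -[X in X ^+ _ <= _]s2 -exprM ler_weXn2l ?sqrt_ge1 // mulnC leq_trunc_div.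
rewrite subr_ge0 ler_pdivlMr // mulrC U /= lerBlDl ler_pdivrMr //.
apply: (le_trans L); rewrite [leRHS]mulrDl [(P h)%:R * _]mulrC lerD2l -mulrA.
rewrite ler_wpM2l // -mulrA ler_wpM2l // (le_trans S) // ler_peMr // exprn_ge0 ?ltW //.
Qed.

(** The right side of [mean_truncLE], with an abstract count [P] of monic irreducibles. *)
Definition mean_of m l : R :=
  \sum_(k < l) \sum_(r < m) (Q - 1) * (P (m * k.+1 - r.+1))%:R / Q ^+ (m * k.+1).

(** The error is [(Q - 1) / Q^(m k)] times the defect of [count_defect]. Since [Q = s^2], the bound
    splits into a factor depending on [k] and one depending on [r]. *)
Lemma error_term m k r (h := (m * k.+1 - r.+1)%N) : (r < m)%N ->
  0 <= w r / h%:R - (Q - 1) * (P h)%:R / Q ^+ (m * k.+1)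
    <= (1 < h)%N%:R * (2 * Q * (s^-1 ^+ (m * k.+1) * s^-1 ^+ r.+1)).
Proof.
move=> rm; have [h0|h0] := posnP h.
  by rewrite h0 P0 invr0 !mulr0 !mul0r subrr lexx.
have [d0 d1] := andP (count_defect h0).
have mE : (m * k.+1 = h + r.+1)%N.
  by rewrite /h subnK // (leq_trans rm) // leq_pmulr.
have hR : h%:R != 0 :> R by rewrite pnatr_eq0 -lt0n.
have -> : w r / h%:R - (Q - 1) * (P h)%:R / Q ^+ (m * k.+1) =
    (Q - 1) / Q ^+ (m * k.+1) * (Q ^+ h / h%:R - (P h)%:R).
  have Qn n : Q ^+ n != 0 by rewrite expf_neq0.
  rewrite /weight mE exprD; move: (Qn h) (Qn r.+1).
  by move: (Q ^+ h) (Q ^+ r.+1) => a b a0 b0; field; rewrite a0 b0 hR.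
have c0 : 0 <= (Q - 1) / Q ^+ (m * k.+1).
  by rewrite divr_ge0 ?exprn_ge0 //; have := Q_ge2; lra.
rewrite mulr_ge0 //=; apply: le_trans (ler_wpM2l c0 d1) _.
rewrite mulrCA ler_wpM2l //.
have -> : 2 * Q * (s^-1 ^+ (m * k.+1) * s^-1 ^+ r.+1) =
    Q / Q ^+ (m * k.+1) * (2 * s ^+ h).
  have sn n : s ^+ n != 0 by rewrite expf_neq0.
  have -> : Q ^+ (m * k.+1) = (s ^+ (m * k.+1)) ^+ 2.
    by rewrite -[LHS](congr1 (fun x => x ^+ (m * k.+1)) s2) -!exprM mulnC.
  rewrite !exprVn mE exprD; move: (sn h) (sn r.+1).
  by move: (s ^+ h) (s ^+ r.+1) => a b a0 b0; field; rewrite a0 b0.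
rewrite ler_wpM2r ?mulr_ge0 ?exprn_ge0 ?(ltW s_gt0) //.
by rewrite ler_wpM2r ?invr_ge0 ?exprn_ge0 // gerBl.
Qed.

Lemma mean_le_approx m l : mean_of m l <= approx R q m l.
Proof.
apply: ler_sum => k _; apply: ler_sum => r _; rewrite -subr_ge0.
by have /andP[] := error_term k (ltn_ord r).
Qed.

(** As [m * k.+1 + r.+1 = h + 2 * r.+1 >= h + 2], the factor [Q = s^2] is absorbed and each term is
    at most [2 / s^h]. Only [h >= 2] contributes, so the total is at most [2 * 4 / s^2]. *)
Lemma error_le_inv m l : approx R q m l - mean_of m l <= 8 / Q.
Proof.
pose G h : R := (1 < h)%N%:R * (2 * s^-1 ^+ h).
apply: (@le_trans _ _ (\sum_(h < m * l) G h)).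
  rewrite sum_blocks -sumrB; apply: ler_sum => k _; rewrite -sumrB.
  apply: ler_sum => r _; have /andP[_] := error_term k (ltn_ord r).
  move=> /le_trans; apply; rewrite /G ler_wpM2l // -mulrA ler_wpM2l //.
  have mE : (m * k.+1 = (m * k.+1 - r.+1) + r.+1)%N.
    by rewrite subnK // (leq_trans (ltn_ord r)) // leq_pmulr.
  rewrite {1}mE exprD -mulrA -exprD addnn.
  rewrite mulrCA ler_piMr ?exprn_ge0 ?invr_ge0 ?(ltW s_gt0) //.
  rewrite -[X in X * _]s2 exprVn ler_pdivrMr ?exprn_gt0 // mul1r.
  by rewrite ler_weXn2l ?sqrt_ge1 //; lia.
rewrite /G; under eq_bigr do rewrite mulrCA.
rewrite -mulr_sumr; have := geometric_tail_le (m * l) sqrt_inv_le.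
rewrite exprVn s2; move: (\sum_(h < _) _) => S; move: (Q^-1) => a; lra.
Qed.

(** The double sum factors into geometric series of ratios [s^-m] and [s^-1], giving
    [2 * Q * (4 / s^m) * (4 / s)]. *)
Lemma error_le_sqrt m l : (0 < m)%N ->
  approx R q m l - mean_of m l <= 32 * (s / s ^+ m).
Proof.
move=> m0; have /andP[t0 t1] := sqrt_inv_le.
have tm : 0 <= s^-1 ^+ m <= 3 / 4.
  rewrite exprn_ge0 //=; apply: le_trans (t1).
  by rewrite -[leRHS]expr1 ler_wiXn2l // (le_trans t1) //; lra.
apply: (@le_trans _ _ (2 * Q * ((\sum_(k < l) (s^-1 ^+ m) ^+ k.+1) *
    \sum_(r < m) s^-1 ^+ r.+1))).
  rewrite mulr_suml mulr_sumr -sumrB; apply: ler_sum => k _.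
  rewrite !mulr_sumr -sumrB; apply: ler_sum => r _.
  have /andP[_] := error_term k (ltn_ord r).
  move=> /le_trans; apply; rewrite exprM ler_piMl //; last by case: ltnP.
have A := geometric_sum_le l tm; have B := geometric_sum_le m sqrt_inv_le.
have A0 : 0 <= \sum_(k < l) (s^-1 ^+ m) ^+ k.+1.
  by apply: sumr_ge0 => k _; rewrite !exprn_ge0.
have B0 : 0 <= \sum_(r < m) s^-1 ^+ r.+1.
  by apply: sumr_ge0 => r _; rewrite exprn_ge0.
have -> : 32 * (s / s ^+ m) = 2 * Q * (4 * s^-1 ^+ m * (4 * s^-1)).
  by rewrite -[X in 2 * X]s2 exprVn; move: (s ^+ m)^-1 => a; field.
by rewrite ler_wpM2l ?mulr_ge0 // ler_pM.
Qed.
End PrimeCountError.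

(** * The three estimates *)

(** In each block of [m] degrees only [r = 0] lies in the residue class [-1]. *)
Lemma sum_inv_residue (R : realType) m l : (0 < m)%N -> (0 < l)%N ->
  \sum_(1 <= h < m * l | (h%:Z == -1 %[mod m%:Z])%Z) h%:R^-1 =
  \sum_(k < l) (m * k.+1 - 1)%:R^-1 :> R.
Proof.
move=> m0 l0; pose G h : R := if (m %| h.+1)%N then h%:R^-1 else 0.
transitivity (\sum_(h < m * l) G h).
  (* The additional index [h = 0] contributes nothing, since [0^-1 = 0]. *)
  rewrite -(big_mkord xpredT) big_ltn ?muln_gt0 ?m0 // /G invr0 if_same add0r.
  rewrite big_mkcond; apply: eq_bigr => h _.
  by rewrite eqz_mod_dvd opprK -PoszD addn1.
rewrite sum_blocks; apply: eq_bigr => k _.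
case: m m0 @G => // m _ G; rewrite (bigD1 ord0) //= [X in _ + X]big1 ?addr0.
  by rewrite /G -subSn ?muln_gt0 // subSS subn0 dvdn_mulr.
move=> r r0; have rk : (r < m.+1 * k.+1)%N.
  by rewrite (leq_trans (ltn_ord r)) // leq_pmulr.
rewrite /G ifN // -subSn // subSS dvdn_subr ?dvdn_mulr // ?(ltnW rk) //.
by rewrite gtnNdvd // lt0n.
Qed.

Lemma powR_half (R : realType) (x : R) m : 0 <= x -> x `^ (m%:R / 2) = Num.sqrt x ^+ m.
Proof. by move=> x0; rewrite mulrC powRrM powR12_sqrt // powR_mulrn // sqrtr_ge0. Qed.

Section MeanEstimates.
Variables (R : realType) (F : finFieldType) (b : {poly F}) (m l : nat).
Hypotheses (sb : size b = m.+1) (m0 : (0 < m)%N) (l0 : (0 < l)%N).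
Local Notation q := #|F|.
Local Notation Q := (q%:R : R).
Local Notation s := (Num.sqrt Q).
Let q1 : (1 < q)%N := finNzRing_gt1 F.
Let P d := size (monic_irr F d).
Let Q_ge2 : 2 <= Q. Proof. by rewrite ler_nat. Qed.
Let Q_gt0 : 0 < Q. Proof. by rewrite ltr0n (ltn_trans _ q1). Qed.
Let m1 : 1 <= m%:R :> R. Proof. by rewrite ler1n. Qed.
Let mR : 0 < m%:R :> R. Proof. by rewrite ltr0n. Qed.
Let ln_l : 0 <= ln l%:R :> R. Proof. by rewrite ln_ge0 // ler1n. Qed.

Lemma mean_error_inv : `|mean_truncL R b l - approx R q m l| <= 8 / Q.
Proof.
rewrite (mean_truncLE R l sb m0) -/(mean_of R q P m l) distrC ger0_norm.
  exact: error_le_inv q1 (monic_irr0 F) (@monic_irr_upper F) (@monic_irr_lower F) m l.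
by rewrite subr_ge0; apply: mean_le_approx q1 (monic_irr0 F)
  (@monic_irr_upper F) (@monic_irr_lower F) m l.
Qed.

Lemma mean_error_sqrt : `|mean_truncL R b l - approx R q m l| <= 32 * (s / s ^+ m).
Proof.
rewrite (mean_truncLE R l sb m0) -/(mean_of R q P m l) distrC ger0_norm.
  exact: error_le_sqrt q1 (monic_irr0 F) (@monic_irr_upper F) (@monic_irr_lower F) m l m0.
by rewrite subr_ge0; apply: mean_le_approx q1 (monic_irr0 F)
  (@monic_irr_upper F) (@monic_irr_lower F) m l.
Qed.

(** The constant is [8 + 130]: the harmonic sum is at most [1 + ln l], and its [1] costs
    [130 / (Q m) <= 130 / Q]. *)
Lemma mean_large_q :
  `|mean_truncL R b l - \sum_(1 <= h < m * l | (h%:Z == -1 %[mod m%:Z])%Z) h%:R^-1|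
  <= 138 * (ln l%:R / (m%:R * Q) + Q^-1).
Proof.
rewrite sum_inv_residue //.
apply: le_trans (ler_distD (approx R q m l) _ _) _.
apply: le_trans (lerD mean_error_inv (approx_leading R q1 l m0)) _.
have H := harmonic_le R l0.
have c0 : 0 <= 130 / Q / m%:R by rewrite !divr_ge0.
apply: (@le_trans _ _ (8 / Q + 130 / Q / m%:R * (1 + ln l%:R))).
  by rewrite lerD2l ler_wpM2l.
have -> : ln l%:R / (m%:R * Q) = ln l%:R * (Q^-1 / m%:R) by rewrite invfM [_^-1 / _]mulrC.
have : 0 <= Q^-1 by rewrite invr_ge0.
have : Q^-1 / m%:R <= Q^-1 by rewrite ler_pdivrMr // ler_peMr // invr_ge0.
have : 0 <= ln l%:R * (Q^-1 / m%:R) by rewrite !mulr_ge0 ?invr_ge0.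
have -> : 130 / Q / m%:R * (1 + ln l%:R) =
    130 * (Q^-1 / m%:R) + 130 * (ln l%:R * (Q^-1 / m%:R)).
  by ring.
by move: (ln l%:R * _) => x; move: (Q^-1 / _) => y; move: Q^-1 => z; lra.
Qed.

Lemma mean_large_m :
  `|mean_truncL R b l
    - (m%:R^-1 * \sum_(1 <= h < l.+1) h%:R^-1
       + Q / ((Q - 1) * m%:R ^+ 2) * \sum_(1 <= h < l.+1) (h%:R ^+ 2)^-1)|
  <= 490 * ((m%:R ^+ 3)^-1 + Q * ln (m%:R * l%:R) ^+ 2 / (Q `^ (m%:R / 2))).
Proof.
rewrite powR_half // !big_add1 /= !big_mkord.
set H := \sum_(k < l) _; set Z := \sum_(k < l) _.
set L := ln (m%:R * l%:R); set D := (s ^+ m)^-1.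
have s1 : 1 <= s := sqrt_ge1 R q1.
have s2 : s * s = Q by rewrite -expr2 sqr_sqrtr.
have D0 : 0 < D by rewrite invr_gt0 exprn_gt0 // (lt_le_trans _ s1).
have Z2 : Z <= 2 := sum_inv_square_le R l.
have Z0 : 0 <= Z by apply: sumr_ge0 => k _; rewrite invr_ge0 exprn_ge0.
have H0 : 0 <= H by apply: sumr_ge0 => k _; rewrite invr_ge0.
have lL : ln l%:R <= L.
  by rewrite ler_ln ?posrE ?mulr_gt0 ?ltr0n // ler_peMl.
have H1 : H <= 1 + L by apply: le_trans (harmonic_le R l0) _; rewrite lerD2l.
(* [s / s^m * (1 + L)] is the unit in which all exponentially small terms are measured. *)
have unit_le : s * D * (1 + L) <= 6 * ((m%:R ^+ 3)^-1 + Q * L ^+ 2 * D).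
  (* For [m = 1], [s * D = 1] while [L] may vanish, so [m^-3 = 1] must absorb the constant. *)
  have [m_le1|m_gt1] := leqP m 1.
    have mE : m = 1%N by apply/eqP; rewrite eqn_leq m_le1.
    have sD : s * D = 1 by rewrite /D mE expr1 mulfV // gt_eqF // (lt_le_trans _ s1).
    have -> : Q * L ^+ 2 * D = s * L ^+ 2 
      by rewrite -[X in X * _ * D]s2 mulrAC -[s * s * D]mulrA sD mulr1.
    rewrite sD mul1r mE expr1n invr1.
    have : L ^+ 2 <= s * L ^+ 2 by rewrite ler_peMl // sqr_ge0.
    by move: (s * _) => y; nra.
  (* Now [L >= ln 2 >= 1 / 2], hence [1 + L <= 6 * L^2], with equality at [1 / 2]: this is the
     source of the [6]. *)
  have L2 : 2^-1 <= L.
    apply: (@le_trans _ _ (ln 2)); first by have := @ln_lower R 2; lra.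
    rewrite ler_ln ?posrE ?mulr_gt0 ?ltr0n //.
    by rewrite -natrM ler_nat (leq_trans m_gt1) // leq_pmulr.
  apply: (@le_trans _ _ (6 * (Q * L ^+ 2 * D))); last first.
    by rewrite ler_wpM2l // lerDr invr_ge0 exprn_ge0.
  have -> : 6 * (Q * L ^+ 2 * D) = s * D * (s * (6 * L ^+ 2)).
    by rewrite -[X in X * _ * D]s2; ring.
  rewrite ler_wpM2l ?mulr_ge0 ?(ltW D0) ?sqrtr_ge0 //.
  by apply: (@le_trans _ _ (6 * L ^+ 2)); [nra | rewrite ler_peMl // mulr_ge0 ?sqr_ge0].
have L0 : 0 <= L := le_trans ln_l lL.
have sD_le : s * D <= s * D * (1 + L).
  by rewrite ler_peMr ?mulr_ge0 ?(ltW D0) ?sqrtr_ge0 // lerDl.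
(* Completing the truncated moments to [1] and [Q / (Q - 1)] leaves terms with the factor
   [Q^-m = D^2 <= s * D]. The constant is [1 + 6]: [H / m <= 1 + L], and the cofactor of [Q^-m] in
   the second term is at most [3 * 2]. *)
have tail_le : `|(Q ^+ m)^-1 / m%:R * H
    + (Q ^+ m)^-1 * (m%:R + Q / (Q - 1)) / m%:R ^+ 2 * Z| <= 7 * (s * D * (1 + L)).
  have c0 : 0 <= (Q ^+ m)^-1 by rewrite invr_ge0 exprn_ge0.
  have c_le : (Q ^+ m)^-1 <= s * D.
    have -> : (Q ^+ m)^-1 = D * D by rewrite -[X in (X ^+ _)^-1 = _]s2 exprMn invfM.
    rewrite ler_wpM2r ?(ltW D0) // (le_trans _ s1) // invf_le1 ?exprn_ege1 //.
    by rewrite exprn_gt0 // (lt_le_trans _ s1).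
  have a0 : 0 <= m%:R^-1 :> R by rewrite invr_ge0.
  have a1 : m%:R^-1 <= 1 :> R by rewrite invf_le1.
  have d_le : 0 <= Q / (Q - 1) <= 2.
    have p0 : 0 < Q - 1 by have := Q_ge2; lra.
    by rewrite divr_ge0 ?(ltW p0) //= ler_pdivrMr //; have := Q_ge2; lra.
  set d := Q / (Q - 1) in d_le *.
  have -> : (Q ^+ m)^-1 * (m%:R + d) / m%:R ^+ 2 * Z =
      (Q ^+ m)^-1 * (m%:R^-1 * (1 + d * m%:R^-1) * Z).
    by move: (Q ^+ m)^-1 => c; field; rewrite gt_eqF.
  rewrite -[_ / m%:R * H]mulrA.
  move: a0 a1 c0 c_le d_le; move: (Q ^+ m)^-1 m%:R^-1 d => c a d.
  move=> a0 a1 c0 c_le /andP[d0 d2].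
  have t1 : 0 <= c * (a * H) <= s * D * (1 + L).
    rewrite !mulr_ge0 //=; apply: ler_pM => //; first exact: mulr_ge0.
    by apply: le_trans H1; rewrite ler_piMl.
  have da : 0 <= d * a <= 2.
    by rewrite mulr_ge0 //= -[2]mulr1 ler_pM.
  have t2 : 0 <= c * (a * (1 + d * a) * Z) <= s * D * 6.
    case/andP: da; move: (d * a) => e e0 e2.
    rewrite !mulr_ge0 //=; last by lra.
    apply: ler_pM => //; first by rewrite !mulr_ge0 //; lra.
    apply: (@le_trans _ _ (3 * 2)); last by lra.
    apply: ler_pM => //; first by rewrite !mulr_ge0 //; lra.
    by rewrite -[3]mul1r ler_pM //; lra.
  rewrite ger0_norm; last by move: t1 t2 => /andP[? _] /andP[? _]; rewrite addr_ge0.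
  move: t1 t2 sD_le => /andP[_] + /andP[_].
  by move: (c * (a * H)) (c * _) (s * D * (1 + L)) => x y u; move: (s * D) => v; lra.
have A := approx_order2 R q1 l m0; have E := mean_error_sqrt.
have Q1 : Q - 1 != 0 by rewrite gt_eqF //; have := Q_ge2; lra.
have mE : mean_truncL R b l - (m%:R^-1 * H + Q / ((Q - 1) * m%:R ^+ 2) * Z) =
    (mean_truncL R b l - approx R q m l) +
    (approx R q m l - ((1 - (Q ^+ m)^-1) / m%:R * H +
     (Q / (Q - 1) - (Q ^+ m)^-1 * (m%:R + Q / (Q - 1))) / m%:R ^+ 2 * Z)) -
    ((Q ^+ m)^-1 / m%:R * H + (Q ^+ m)^-1 * (m%:R + Q / (Q - 1)) / m%:R ^+ 2 * Z).
  have mn : m%:R != 0 :> R by rewrite gt_eqF.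
  by move: (Q ^+ m)^-1 => a; field; rewrite Q1 mn.
(* With [v = s * D] and [u = v * (1 + L)], the three parts cost [32 * v], [256 / m^3] and [7 * u].
   As [v <= u], [unit_le] yields [39 * 6 + 256 = 490]. *)
rewrite mE; apply: le_trans (ler_normB _ _) _.
apply: le_trans (lerD (ler_normD _ _) tail_le) _.
apply: le_trans (lerD (lerD E A) (lexx _)) _.
have b0 : 0 <= Q * L ^+ 2 * D by rewrite !mulr_ge0 ?sqr_ge0 ?(ltW D0).
rewrite -/D; move: unit_le sD_le b0.
move: (s * D * (1 + L)) => u; move: (s * D) => v; move: (Q * L ^+ 2 * D) => c.
by move: (m%:R ^+ 3)^-1 => a; lra.
Qed.

(** The prime count costs [8 / Q], the first-order expansion [128 / m^2], and replacing the harmonic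
    sum by [ln l] at most [1 / m]. *)
Lemma mean_large_l :
  `|mean_truncL R b l - m%:R^-1 * (1 - (Q ^+ m)^-1) * ln l%:R|
  <= 130 * (m%:R^-1 + Q^-1).
Proof.
apply: le_trans (ler_distD (approx R q m l) _ _) _.
apply: le_trans (lerD mean_error_inv (ler_distD _ _ _)) _.
apply: le_trans (lerD (lexx _) (lerD (approx_order1 R q1 l m0) (lexx _))) _.
set c := (Q ^+ m)^-1.
have c1 : 0 <= c <= 1.
  by rewrite invr_ge0 exprn_ge0 //= invf_le1 ?exprn_gt0 // exprn_ege1 // ler1n ltnW.
rewrite [m%:R^-1 * _]mulrC -mulrBr normrM ger0_norm; last first.
  by rewrite mulr_ge0 ?invr_ge0 //; lra.
have Hl : `|\sum_(k < l) k.+1%:R^-1 - ln l%:R| <= 1 :> R.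
  rewrite ger0_norm ?subr_ge0 ?harmonic_ge // lerBlDl addrC harmonic_le //.
have a0 : 0 <= m%:R^-1 :> R by rewrite invr_ge0.
have a1 : m%:R^-1 <= 1 :> R by rewrite invf_le1.
rewrite -exprVn; have q0 : 0 <= Q^-1 by rewrite invr_ge0.
move: Hl (normr_ge0 (\sum_(k < l) k.+1%:R^-1 - ln l%:R : R)); move: `|_| => h h1 h0.
move: a0 a1 q0 c1; move: (m%:R^-1) (Q^-1) c => a z c a0 a1 z0 /andP[c0 c1].
have : (1 - c) * a * h <= a.
  rewrite -[leRHS]mulr1; apply: ler_pM => //; first by rewrite mulr_ge0 // subr_ge0.
  by rewrite ler_piMl // gerBl.
by nra.
Qed.
End MeanEstimates.

Theorem theorem1p2 (R : realType) :
  (exists C : R, 0 < C /\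
    forall (q : nat) (F : finFieldType) (b : {poly F}) (m l : nat),
      #|F| = q -> size b = m.+1 -> (1 <= m)%N -> (1 <= l)%N ->
      `| mean_truncL R b l
         - \sum_(1 <= h < m * l | (h%:Z == -1 %[mod m%:Z])%Z) h%:R^-1 |
      <= C * (ln l%:R / (m%:R * q%:R) + q%:R^-1))
  /\
  (exists C : R, 0 < C /\
    forall (q : nat) (F : finFieldType) (b : {poly F}) (m l : nat),
      #|F| = q -> size b = m.+1 -> (1 <= m)%N -> (1 <= l)%N ->
      `| mean_truncL R b l
         - (m%:R^-1 * \sum_(1 <= h < l.+1) h%:R^-1
            + q%:R / ((q%:R - 1) * m%:R ^+ 2)
              * \sum_(1 <= h < l.+1) (h%:R ^+ 2)^-1) |
      <= C * ((m%:R ^+ 3)^-1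
              + q%:R * ln (m%:R * l%:R) ^+ 2 / (q%:R `^ (m%:R / 2))))
  /\
  (exists C : R, 0 < C /\
    forall (q : nat) (F : finFieldType) (b : {poly F}) (m l : nat),
      #|F| = q -> size b = m.+1 -> (1 <= m)%N -> (1 <= l)%N ->
      `| mean_truncL R b l
         - m%:R^-1 * (1 - (q%:R ^+ m)^-1) * ln l%:R |
      <= C * (m%:R^-1 + q%:R^-1)).
Proof.
split; [|split].
- by exists 138; split=> // _ F b m l <-; exact: mean_large_q.
- by exists 490; split=> // _ F b m l <-; exact: mean_large_m.
- by exists 130; split=> // _ F b m l <-; exact: mean_large_l.
Qed.
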